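(* Let each $\ell_i:\mathbb{R}\to\mathbb{R}$ ($i\in[n]$) be convex and $G_i$-Lipschitz with $G_i>0$, and let $f(\mathbf{x})=\frac1n\sum_{i=1}^n\ell_i(\mathbf{a}_i^\top\mathbf{x})$ have a minimizer $\mathbf{x}_*\in\mathbb{R}^d$. Run shuffled SGD (Algorithm 1, described in the context) for $K\ge1$ epochs with batch size $b$, deterministic step sizes $\eta_1,\dots,\eta_K>0$, and possible uniformly random shuffling (RR, SO, or a fixed permutation). Let $H_K=\sum_{k=1}^K\eta_k$ and $\bar G=\mathbb{E}_\pi\big[\sqrt{\hat G_\pi\tilde G_\pi}\big]$, where $\pi$ is a uniformly random permutation of $[n]$ for RR/SO, and $\pi$ is the fixed permutation used (so no expectation is involved) in the fixed-permutation case. Then the output $\hat{\mathbf{x}}_K$ satisfies $$\mathbb{E}\big[H_K\big(f(\hat{\mathbf{x}}_K)-f(\mathbf{x}_* )\big)\big]\le\frac{b}{2n}\|\mathbf{x}_0-\mathbf{x}_*\|_2^2+\sum_{k=1}^K\frac{2\eta_k^2n\bar G}{b}.$$ Consequently, for any $\epsilon>0$, there exists a constant step size $\eta_k=\eta$ such that $\mathbb{E}[f(\hat{\mathbf{x}}_K)-f(\mathbf{x}_* )]\le\epsilon$ after $\mathcal{O}\big(\frac{n\bar G\|\mathbf{x}_0-\mathbf{x}_*\|_2^2}{\epsilon^2}\big)$ individual gradient queries; that is, there is an absolute constant $C>0$ such that for every $\epsilon>0$ and every integer $K\ge1$ with $nK\ge C\,n\bar G\|\mathbf{x}_0-\mathbf{x}_*\|_2^2/\epsilon^2$,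 some constant step size $\eta>0$ gives $\mathbb{E}[f(\hat{\mathbf{x}}_K)-f(\mathbf{x}_* )]\le\epsilon$.
   Context: Setting: $n,d,b,m\ge 1$ are integers with $n=bm$; $[n]=\{1,\dots,n\}$; $\mathbf{a}_1,\dots,\mathbf{a}_n\in\mathbb{R}^d$. $\ell_i$ is $G_i$-Lipschitz if $|\ell_i(x)-\ell_i(y)|\le G_i|x-y|$ for all $x,y\in\mathbb{R}$. $\ell_i^*$ denotes the convex conjugate of $\ell_i$. $\|\cdot\|_2$ is the Euclidean norm for vectors and the operator norm for matrices. For a permutation $\pi=(\pi_1,\dots,\pi_n)$ of $[n]$: $\mathbf{A}_\pi=[\mathbf{a}_{\pi_1},\dots,\mathbf{a}_{\pi_n}]^\top\in\mathbb{R}^{n\times d}$ and $\boldsymbol\Gamma_\pi=\mathrm{diag}(G_{\pi_1}^2,\dots,G_{\pi_n}^2)$. $\mathbf{I}_{j\uparrow}$ is the $n\times n$ identity matrix with its first $j$ diagonal entries set to zero; $\mathbf{I}_{(j)}$ is the $n\times n$ diagonal matrix with diagonal entries $1$ in positions $b(j-1)+1,\dots,bj$ and $0$ elsewhere. Define $$\hat G_\pi=\frac1{mn}\Big\|\boldsymbol\Gamma_\pi^{1/2}\Big(\sum_{j=1}^m\mathbf{I}_{b(j-1)\uparrow}\mathbf{A}_\pi\mathbf{A}_\pi^\top\mathbf{I}_{b(j-1)\uparrow}\Big)\boldsymbol\Gamma_\pi^{1/2}\Big\|_2,\qquad \tilde G_\pi=\frac1b\Big\|\boldsymbol\Gamma_\pi^{1/2}\Big(\sum_{j=1}^m\mathbf{I}_{(j)}\mathbf{A}_\pi\mathbf{A}_\pi^\top\mathbf{I}_{(j)}\Big)\boldsymbol\Gamma_\pi^{1/2}\Big\|_2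 .$$ Algorithm 1 (shuffled SGD, primal-dual view). Input: $\mathbf{x}_0\in\mathbb{R}^d$, batch size $b$, step sizes $\eta_k>0$, number of epochs $K$. For $k=1,\dots,K$: choose a permutation $\pi^{(k)}$ of $[n]$; set $\mathbf{A}_k=\mathbf{A}_{\pi^{(k)}}$, and let $\mathbf{A}_k^{(i)}\in\mathbb{R}^{b\times d}$ consist of rows $b(i-1)+1,\dots,bi$ of $\mathbf{A}_k$; set $\mathbf{x}_{k-1,1}=\mathbf{x}_{k-1}$; for $i=1,\dots,m$ let $\mathbf{y}_k^{(i)}\in\operatorname{argmax}_{\mathbf{y}\in\mathbb{R}^b}\{\mathbf{y}^\top\mathbf{A}_k^{(i)}\mathbf{x}_{k-1,i}-\sum_{j=1}^b\ell^*_{\pi^{(k)}_{b(i-1)+j}}(\mathbf{y}^j)\}$ (any maximizer) and $\mathbf{x}_{k-1,i+1}=\operatorname{argmin}_{\mathbf{x}\in\mathbb{R}^d}\{\mathbf{y}_k^{(i)\top}\mathbf{A}_k^{(i)}\mathbf{x}+\frac{b}{2\eta_k}\|\mathbf{x}-\mathbf{x}_{k-1,i}\|_2^2\}$; then set $\mathbf{x}_k=\mathbf{x}_{k-1,m+1}$. Equivalently, $\mathbf{x}_{k-1,i+1}=\mathbf{x}_{k-1,i}-\frac{\eta_k}{b}\sum_{j=b(i-1)+1}^{bi}g_j\,\mathbf{a}_{\pi_j^{(k)}}$ with $g_j\in\partial\ell_{\pi_j^{(k)}}(\mathbf{a}_{\pi_j^{(k)}}^\top\mathbf{x}_{k-1,i})$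 (a subgradient). Output: $\hat{\mathbf{x}}_K=\sum_{k=1}^K\eta_k\mathbf{x}_k/\sum_{k=1}^K\eta_k$. Each epoch uses $n$ individual (sub)gradient queries. Shuffling schemes: RR (random reshuffling): $\pi^{(1)},\dots,\pi^{(K)}$ are independent uniformly random permutations of $[n]$. SO (shuffle once): $\pi^{(k)}=\pi$ for all $k$, with a single uniformly random permutation $\pi$. Fixed permutation (incremental gradient): $\pi^{(k)}=\pi^{(0)}$ for all $k$, deterministic. Expectations are over this randomness; $\mathbf{x}_0$ is deterministic. *)

(* Defs.v *)
From HB Require Import structures.
From mathcomp Require Import all_boot all_order all_algebra all_fingroup.
From mathcomp Require Import all_classical all_reals all_analysis.

Set Implicit Arguments.
Unset Strict Implicit.
Unset Printing Implicit Defensive.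

Import Order.TTheory GRing.Theory Num.Theory.
Import numFieldNormedType.Exports.
Local Open Scope classical_set_scope.
Local Open Scope ring_scope.

(* All indices are 0-based: component [i] of a data vector, position [p] of a
    permutation, batch [i], epoch [k] stand for the usual [i + 1], [p + 1]...
    The sample size is [n = b * m], [m] batches of size [b]. *)

Section Norms.
Context {R : realType}.

Definition l2norm {p : nat} (v : 'cV[R]_p) : R :=
  Num.sqrt (\sum_(i < p) v i 0 ^+ 2).

Definition opnorm {p q : nat} (M : 'M[R]_(p, q)) : R :=
  sup [set l2norm (M *m v) | v in [set v : 'cV[R]_q | l2norm v <= 1]].

End Norms.

Section Optimization.
Context {R : realType}.

Definition convex_conjugate (l : R -> R) (y : R) : \bar R :=
  ereal_sup [set (y * t - l t)%:E | t in [set: R]].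

Definition argmax {T : Type} (F : T -> \bar R) : set T :=
  [set t | forall u, (F u <= F t)%E].

Definition argmin {T : Type} (F : T -> R) : set T :=
  [set t | forall u, F t <= F u].

End Optimization.

Section Data.
Context {R : realType} {n d : nat}.
Variables (a : 'I_n -> 'cV[R]_d) (ell : 'I_n -> R -> R) (G : 'I_n -> R).

Definition objective (x : 'cV[R]_d) : R :=
  n%:R^-1 * \sum_(i < n) ell i (((a i)^T *m x) 0 0).

Definition data_mx (pi : 'S_n) : 'M[R]_(n, d) :=
  \matrix_(p < n, l < d) a (pi p) l 0.

(* The square root of the diagonal matrix diag(G_(pi 0)^2, G_(pi 1)^2, ...). *)
Definition sqrt_Gamma (pi : 'S_n) : 'M[R]_n :=
  diag_mx (\row_(p < n) Num.sqrt (G (pi p) ^+ 2)).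

Definition id_from (j : nat) : 'M[R]_n :=
  diag_mx (\row_(p < n) (j <= p)%N%:R).

Definition id_batch (b j : nat) : 'M[R]_n :=
  diag_mx (\row_(p < n) (b * j <= p < b * j.+1)%N%:R).

Definition G_hat (b m : nat) (pi : 'S_n) : R :=
  let A := data_mx pi in
  (m * n)%N%:R^-1 *
  opnorm (sqrt_Gamma pi *m
          (\sum_(j < m) id_from (b * j) *m A *m A^T *m id_from (b * j)) *m
          sqrt_Gamma pi).

Definition G_tilde (b m : nat) (pi : 'S_n) : R :=
  let A := data_mx pi in
  b%:R^-1 *
  opnorm (sqrt_Gamma pi *m
          (\sum_(j < m) id_batch b j *m A *m A^T *m id_batch b j) *m
          sqrt_Gamma pi).

End Data.

Section Shuffling.

Inductive scheme (n : nat) : Type :=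
| RandomReshuffling
| ShuffleOnce
| FixedPermutation of 'S_n.

(* Under the uniform law on the finite sample space, the epoch permutations of
   [RandomReshuffling] are independent and uniform, and the single permutation
   of [ShuffleOnce] is uniform. *)
Definition sample (n K : nat) (s : scheme n) : finType :=
  match s with
  | RandomReshuffling => {ffun 'I_K -> 'S_n}
  | ShuffleOnce => 'S_n
  | FixedPermutation _ => unit
  end.

Definition epoch_perm (n K : nat) (s : scheme n) :
    sample K s -> 'I_K -> 'S_n :=
  match s return sample K s -> 'I_K -> 'S_n with
  | RandomReshuffling => fun w k => w k
  | ShuffleOnce => fun w _ => w
  | FixedPermutation pi0 => fun _ _ => pi0
  end.

Context {R : realType}.

Definition expectation_unif {W : finType} (F : W -> R) : R :=
  (\sum_w F w) / #|W|%:R.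

Definition G_bar (b m d : nat) (a : 'I_(b * m) -> 'cV[R]_d)
    (G : 'I_(b * m) -> R) (s : scheme (b * m)) : R :=
  let g pi := Num.sqrt (G_hat a G b m pi * G_tilde a G b m pi) in
  match s with
  | RandomReshuffling | ShuffleOnce => expectation_unif g
  | FixedPermutation pi0 => g pi0
  end.

End Shuffling.

Section ShuffledSGD.

Lemma batch_pos_subproof (b m : nat) (i : 'I_m) (j : 'I_b) :
  (b * i + j < b * m)%N.
Proof.
apply: (@leq_trans (b * i.+1)%N); last by rewrite leq_mul2l ltn_ord orbT.
by rewrite mulnS addnC ltn_add2r.
Qed.

Definition batch_pos (b m : nat) (i : 'I_m) (j : 'I_b) : 'I_(b * m) :=
  Ordinal (batch_pos_subproof i j).

Context {R : realType} {b m d K : nat}.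
Variables (a : 'I_(b * m) -> 'cV[R]_d) (ell : 'I_(b * m) -> R -> R).

Definition batch_mx (pi : 'S_(b * m)) (i : 'I_m) : 'M[R]_(b, d) :=
  rowsub (@batch_pos b m i) (data_mx a pi).

Definition dual_objective (pi : 'S_(b * m)) (i : 'I_m) (x : 'cV[R]_d)
    (y : 'cV[R]_b) : \bar R :=
  (((y^T *m batch_mx pi i *m x) 0 0)%:E
   - \sum_(j < b) convex_conjugate (ell (pi (batch_pos i j))) (y j 0)%R)%E.

Definition primal_objective (pi : 'S_(b * m)) (i : 'I_m) (eta : R)
    (x : 'cV[R]_d) (y : 'cV[R]_b) (z : 'cV[R]_d) : R :=
  (y^T *m batch_mx pi i *m z) 0 0
  + b%:R / (2 * eta) * l2norm (z - x) ^+ 2.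

(* A run of the algorithm along given epoch permutations; the dual step may
   return any maximizer. [outer k] is x_k, and [inner k i] is x_(k, i+1), the
   iterate before batch [i] (0-based) of the epoch that starts from x_k.  The
   values [outer k] for k > K and [inner k i] for i > m are irrelevant. *)
Record sgd_run (x0 : 'cV[R]_d) (eta : 'I_K -> R) (pi : 'I_K -> 'S_(b * m)) :=
  SgdRun {
    outer : nat -> 'cV[R]_d;
    inner : 'I_K -> nat -> 'cV[R]_d;
    dual : 'I_K -> 'I_m -> 'cV[R]_b;
    run_init : outer 0 = x0;
    run_start : forall k : 'I_K, inner k 0 = outer k;
    run_dual : forall (k : 'I_K) (i : 'I_m),
      argmax (dual_objective (pi k) i (inner k i)) (dual k i);
    run_primal : forall (k : 'I_K) (i : 'I_m),
      argmin (primal_objective (pi k) i (eta k) (inner k i) (dual k i))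
             (inner k i.+1);
    run_end : forall k : 'I_K, outer k.+1 = inner k m
  }.

Definition output x0 eta pi (r : sgd_run x0 eta pi) : 'cV[R]_d :=
  (\sum_(k < K) eta k)^-1 *: \sum_(k < K) eta k *: outer r k.+1.

End ShuffledSGD.

(* Main.v *)
Require Import Defs.
From HB Require Import structures.
From mathcomp Require Import all_boot all_order all_algebra all_fingroup.
From mathcomp Require Import all_classical all_reals all_analysis.
From mathcomp Require Import ring lra.
Set Implicit Arguments.
Unset Strict Implicit.
Unset Printing Implicit Defensive.
Import Order.TTheory GRing.Theory Num.Theory.
Import numFieldNormedType.Exports.
Local Open Scope classical_set_scope.
Local Open Scope ring_scope.

(** Fix an epoch with permutation [pi], iterates [x_0, ..., x_m] before and
    after each batch, and a comparison point [z].  Let [p] be a position in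
    batch [i], let [ell_p] and [a_p] be the loss and the data vector there, and
    let [y_p] be the dual coordinate.  Fenchel-Young equality makes [y_p] a
    subgradient of [ell_p] at [<a_p, x_i>] ([dual_step]).  Let [v_p] be the slope
    of the secant of [ell_p] between [<a_p, x_i>] and [<a_p, x_m>].  Then
    [[
      ell_p <a_p, x_m> - ell_p <a_p, z>
        <= y_p <a_p, x_m - z> + (v_p - y_p) <a_p, x_m - x_i>.
    ]]
    Every primal step is an explicit gradient step ([primal_step]), so the
    dual-weighted data vectors add up to [(b / eta) (x_0 - x_m)].  The first
    terms therefore sum to a three-point expression which telescopes over the
    epochs.

    The second terms measure how far the iterate drifts within the epoch.  Here
    [x_m - x_i] is [- (eta / b) A^T I_(from batch i) y], so their sum is a sum
    over the batches of inner products between [A^T I_(batch i) (v - y)] and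
    [A^T I_(from batch i) y].  Cauchy-Schwarz over the batches separates the two
    families, and since [|y_p| <= G_p] and [|v_p - y_p| <= 2 G_p], the
    two sums of squares are quadratic forms of the matrices whose operator norms
    define [G_hat] and [G_tilde] ([drift_le]).  This yields [epoch_progress].

    Summing over the epochs and using convexity of the objective bounds every
    single run ([run_bound]).  The right-hand side is a sum of functions of one
    epoch permutation each; every such permutation has the law of [G_bar]
    whichever the scheme ([expectation_epoch_perm]), so that linearity of
    expectation suffices.  Balancing the two terms of the bound by the choice of
    a constant step size gives the complexity, with absolute constant 4. *)

(** * Euclidean inner product and operator norm *)

Section InnerProduct.
Context {R : realType}.

Definition dot {p : nat} (u v : 'cV[R]_p) : R := (u^T *m v) 0 0.

Lemma dotE p (u v : 'cV[R]_p) : dot u v = \sum_i u i 0 * v i 0.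
Proof. by rewrite /dot mxE; apply: eq_bigr => i _; rewrite mxE. Qed.

Lemma dotC p (u v : 'cV[R]_p) : dot u v = dot v u.
Proof. by rewrite !dotE; apply: eq_bigr => i _; rewrite mulrC. Qed.

Lemma dotDl p (u v w : 'cV[R]_p) : dot (u + v) w = dot u w + dot v w.
Proof. by rewrite /dot linearD mulmxDl mxE. Qed.

Lemma dotZl p c (u v : 'cV[R]_p) : dot (c *: u) v = c * dot u v.
Proof. by rewrite /dot linearZ -scalemxAl mxE. Qed.

Lemma dotDr p (u v w : 'cV[R]_p) : dot u (v + w) = dot u v + dot u w.
Proof. by rewrite dotC dotDl !(dotC _ u). Qed.

Lemma dotZr p c (u v : 'cV[R]_p) : dot u (c *: v) = c * dot u v.
Proof. by rewrite dotC dotZl dotC. Qed.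

Lemma dotNl p (u v : 'cV[R]_p) : dot (- u) v = - dot u v.
Proof. by rewrite -scaleN1r dotZl mulN1r. Qed.

Lemma dotBr p (u v w : 'cV[R]_p) : dot u (v - w) = dot u v - dot u w.
Proof. by rewrite dotDr -(scaleN1r w) dotZr mulN1r. Qed.

Lemma dotBl p (u v w : 'cV[R]_p) : dot (u - v) w = dot u w - dot v w.
Proof. by rewrite dotDl dotNl. Qed.

Lemma dot_suml p (I : finType) (F : I -> 'cV[R]_p) w :
  dot (\sum_i F i) w = \sum_i dot (F i) w.
Proof. by rewrite /dot linear_sum mulmx_suml summxE. Qed.

Lemma dot_sumr p (I : finType) (F : I -> 'cV[R]_p) w :
  dot w (\sum_i F i) = \sum_i dot w (F i).
Proof. by rewrite dotC dot_suml; apply: eq_bigr => i _; rewrite dotC. Qed.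

Lemma dot_mulmx p q (A : 'M[R]_(p, q)) (u : 'cV[R]_q) (v : 'cV[R]_p) :
  dot (A *m u) v = dot u (A^T *m v).
Proof. by rewrite /dot trmx_mul mulmxA. Qed.

Lemma sqr_l2norm p (v : 'cV[R]_p) : l2norm v ^+ 2 = dot v v.
Proof.
rewrite sqr_sqrtr ?dotE; first by apply: eq_bigr => i _; rewrite expr2.
by apply: sumr_ge0 => i _; rewrite sqr_ge0.
Qed.

Lemma l2norm_ge0 p (v : 'cV[R]_p) : 0 <= l2norm v.
Proof. exact: sqrtr_ge0. Qed.

Lemma dot_ge0 p (v : 'cV[R]_p) : 0 <= dot v v.
Proof. by rewrite -sqr_l2norm sqr_ge0. Qed.

Lemma dot_eq0 p (v : 'cV[R]_p) : dot v v <= 0 -> v = 0.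
Proof.
move=> v0; have /eqP : dot v v = 0 by apply/le_anti; rewrite v0 dot_ge0.
rewrite dotE psumr_eq0 => [/allP vz|i _]; last by rewrite -expr2 sqr_ge0.
apply/colP => i; rewrite mxE; apply/eqP; rewrite -sqrf_eq0 expr2.
exact: vz (mem_index_enum i).
Qed.

Lemma l2normZ p c (v : 'cV[R]_p) : 0 <= c -> l2norm (c *: v) = c * l2norm v.
Proof.
move=> c0; apply/eqP.
rewrite -(eqrXn2 (n := 2)) ?mulr_ge0 ?l2norm_ge0//.
by rewrite exprMn !sqr_l2norm dotZl dotZr mulrA expr2.
Qed.

Lemma cauchy_schwarz_sqr (I : finType) (f g : I -> R) :
  (\sum_i f i * g i) ^+ 2 <= (\sum_i f i ^+ 2) * (\sum_i g i ^+ 2).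
Proof.
set F := \sum_i f i ^+ 2; set X := \sum_i f i * g i; set H := \sum_i g i ^+ 2.
have H0 : 0 <= H by apply: sumr_ge0 => i _; rewrite sqr_ge0.
(* H f - X g is H times the residual of projecting f on the line of g. *)
have key : 0 <= H * (F * H - X ^+ 2).
  have -> : H * (F * H - X ^+ 2) = \sum_i (H * f i - X * g i) ^+ 2.
    rewrite (eq_bigr (fun i => H ^+ 2 * f i ^+ 2 - 2 * H * X * (f i * g i)
               + X ^+ 2 * g i ^+ 2)); last by move=> i _; ring.
    rewrite big_split/= sumrB -!mulr_sumr -/F -/X -/H; ring.
  by apply: sumr_ge0 => i _; rewrite sqr_ge0.
move: H0; rewrite le_eqVlt => /predU1P[H0|Hgt0]; last first.
  by move: key; rewrite pmulr_rge0// subr_ge0.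
suff -> : X = 0 by rewrite expr0n/= -H0 mulr0.
apply: big1 => i _; move/esym/eqP: H0; rewrite psumr_eq0; last first.
  by move=> j _; rewrite sqr_ge0.
by move=> /allP/(_ i (mem_index_enum i)); rewrite sqrf_eq0 => /eqP->;
   rewrite mulr0.
Qed.

(** Cauchy-Schwarz in the direct sum of one copy of the space per index, with the
    sign in which the drift of the iterates appears. *)
Lemma cauchy_schwarz_sum (I : finType) p (u w : I -> 'cV[R]_p) :
  - \sum_i dot (u i) (w i) <=
  Num.sqrt ((\sum_i dot (u i) (u i)) * (\sum_i dot (w i) (w i))).
Proof.
apply: le_trans (ler_norm _) _; rewrite normrN -sqrtr_sqr; apply: ler_wsqrtr.
under eq_bigr do rewrite dotE; rewrite pair_bigA/=.
apply: le_trans (cauchy_schwarz_sqr _ _) _.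
under [in leRHS]eq_bigr do rewrite dotE.
under [X in _ <= _ * X]eq_bigr do rewrite dotE.
rewrite !pair_bigA/=.
under eq_bigr do rewrite expr2.
by under [X in _ * X <= _]eq_bigr do rewrite expr2.
Qed.

Lemma cauchy_schwarz p (u v : 'cV[R]_p) : dot u v <= l2norm u * l2norm v.
Proof.
apply: le_trans (ler_norm _) _.
rewrite -sqrtr_sqr -(@ger0_norm _ (_ * _)) ?mulr_ge0 ?l2norm_ge0// -sqrtr_sqr.
apply: ler_wsqrtr; rewrite exprMn !sqr_l2norm !dotE.
apply: le_trans (cauchy_schwarz_sqr _ _) _.
by under eq_bigr do rewrite expr2; under [X in _ * X]eq_bigr do rewrite expr2.
Qed.

Lemma l2norm_mulmx_bounded p q (M : 'M[R]_(p, q)) (v : 'cV[R]_q) :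
  l2norm v <= 1 ->
  l2norm (M *m v) <= Num.sqrt (\sum_i \sum_j M i j ^+ 2).
Proof.
move=> v1; apply: ler_wsqrtr; apply: ler_sum => i _.
rewrite mxE; apply: le_trans (cauchy_schwarz_sqr _ _) _.
rewrite ler_piMr//; first by apply: sumr_ge0 => j _; rewrite sqr_ge0.
rewrite -[leLHS]sqr_sqrtr; last by apply: sumr_ge0 => j _; rewrite sqr_ge0.
by rewrite -/(l2norm v) expr_le1 ?l2norm_ge0.
Qed.

(** A bound on the set is indispensable: [opnorm] is a real supremum, which has
    a meaningful value only when the set is bounded. *)
Lemma has_sup_opnorm p q (M : 'M[R]_(p, q)) :
  has_sup [set l2norm (M *m v) | v in [set v : 'cV[R]_q | l2norm v <= 1]].
Proof.
split.
  exists (l2norm (M *m 0)), 0 => //=; rewrite -(scale0r 0) l2normZ// mul0r.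
  exact: ler01.
by exists (Num.sqrt (\sum_i \sum_j M i j ^+ 2)) => _ [v v1 <-];
   exact: l2norm_mulmx_bounded.
Qed.

Lemma opnorm_ge0 p q (M : 'M[R]_(p, q)) : 0 <= opnorm M.
Proof.
apply: le_trans (l2norm_ge0 (M *m 0)) _.
apply: (sup_upper_bound (has_sup_opnorm M)); exists 0 => //=.
by rewrite -(scale0r 0) l2normZ// mul0r ler01.
Qed.

Lemma l2norm_mulmx_le p q (M : 'M[R]_(p, q)) (v : 'cV[R]_q) :
  l2norm (M *m v) <= opnorm M * l2norm v.
Proof.
have [v0|vn0] := leP (l2norm v) 0.
  have -> : v = 0.
    apply: dot_eq0; rewrite -sqr_l2norm.
    suff -> : l2norm v = 0 by rewrite expr0n.
    by apply/le_anti; rewrite v0 l2norm_ge0.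
  by rewrite mulmx0 -(scale0r 0) l2normZ// mul0r mulr_ge0 ?opnorm_ge0
    ?l2norm_ge0.
rewrite -ler_pdivrMr// mulrC -l2normZ ?invr_ge0 ?l2norm_ge0// scalemxAr.
apply: (sup_upper_bound (has_sup_opnorm M)); exists ((l2norm v)^-1 *: v) => //=.
by rewrite l2normZ ?invr_ge0 ?l2norm_ge0// mulVf// gt_eqF.
Qed.

Lemma quadratic_form_le p (M : 'M[R]_p) (u : 'cV[R]_p) :
  dot u (M *m u) <= opnorm M * dot u u.
Proof.
apply: le_trans (cauchy_schwarz _ _) _.
rewrite -sqr_l2norm expr2 mulrA [leRHS]mulrC ler_wpM2l ?l2norm_ge0//.
exact: l2norm_mulmx_le.
Qed.

(** The left-hand side is the quadratic form at [u] of the matrix on the right: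
    the common shape of [G_hat] and [G_tilde], for [S] the square root of
    Gamma and [D] either family of diagonal projections. *)
Lemma le_sum_sqr_opnorm (J : finType) n d (A : 'M[R]_(n, d)) (S : 'M[R]_n)
    (D : J -> 'M[R]_n) (u : 'cV[R]_n) :
    S^T = S -> (forall j, (D j)^T = D j) ->
  \sum_j dot (A^T *m D j *m (S *m u)) (A^T *m D j *m (S *m u)) <=
  opnorm (S *m (\sum_j D j *m A *m A^T *m D j) *m S) * dot u u.
Proof.
move=> ST DT; apply: le_trans (quadratic_form_le _ _).
rewrite -!mulmxA mulmx_suml mulmx_sumr dot_sumr le_eqVlt; apply/orP; left.
apply/eqP/eq_bigr => j _.
by rewrite !dot_mulmx !trmx_mul ST DT trmxK !mulmxA.
Qed.

End InnerProduct.

(** * Subgradients and conjugates of convex functions of one variable *)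

Section Subgradient.
Context {R : realType}.
Implicit Types (l : R -> R) (s t u y : R).

Definition subgradient l t y := forall u, l t + y * (u - t) <= l u.

Lemma convex_three_chords l s t u :
  convex_function setT (l : R^o -> R^o) -> s < t -> t < u ->
  (l t - l s) / (t - s) <= (l u - l t) / (u - t).
Proof.
move=> cvx st tu.
have st0 : 0 < t - s by rewrite subr_gt0.
have tu0 : 0 < u - t by rewrite subr_gt0.
have su0 : 0 < u - s by lra.
have q0 : 0 <= (u - t) / (u - s) by rewrite divr_ge0// ltW.
have q1 : (u - t) / (u - s) <= 1 by rewrite ler_pdivrMr// mul1r; lra.
have : l ((u - t) / (u - s) * s + (1 - (u - t) / (u - s)) * u) <=
    (u - t) / (u - s) * l s + (1 - (u - t) / (u - s)) * l u.
  exact: (cvx (Itv01 q0 q1) s u (in_setT _) (in_setT _)).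
have -> : (u - t) / (u - s) * s + (1 - (u - t) / (u - s)) * u = t.
  by field; rewrite gt_eqF.
have -> : (u - t) / (u - s) * l s + (1 - (u - t) / (u - s)) * l u =
  ((u - t) * l s + (t - s) * l u) / (u - s) by field; rewrite gt_eqF.
rewrite ler_pdivlMr// => H.
rewrite ler_pdivrMr// mulrAC ler_pdivlMr//; nra.
Qed.

(** The left derivative, as the supremum of the slopes of the chords ending at
    [t], is a subgradient: the slopes of the chords starting at [t] bound it. *)
Lemma convex_subgradient l t :
  convex_function setT (l : R^o -> R^o) -> exists y, subgradient l t y.
Proof.
move=> cvx; pose E := [set (l t - l s) / (t - s) | s in [set s | s < t]].
have E0 : E !=set0.
  by exists ((l t - l (t - 1)) / (t - (t - 1))), (t - 1) => //=; lra.
have ubE u : t < u -> ubound E ((l u - l t) / (u - t)).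
  by move=> tu _ [s /= st <-]; exact: convex_three_chords.
have supE : has_sup E.
  by split=> //; exists ((l (t + 1) - l t) / (t + 1 - t)); apply: ubE; lra.
exists (sup E) => u; have [ut|tu|->] := ltgtP u t.
- have : (l t - l u) / (t - u) <= sup E.
    by apply: (sup_upper_bound supE); exists u.
  by rewrite ler_pdivrMr ?subr_gt0//; lra.
- have := ge_sup E0 (ubE _ tu).
  by rewrite ler_pdivlMr ?subr_gt0//; lra.
- by rewrite subrr mulr0 addr0.
Qed.

Lemma lipschitz_dist (k : R) l t u :
  k.-lipschitz (l : R^o -> R^o) -> `|l t - l u| <= k * `|t - u|.
Proof. by move=> /(_ (t, u)) /=; apply. Qed.

Lemma subgradient_lipschitz (k : R) l t y :
  k.-lipschitz (l : R^o -> R^o) -> subgradient l t y -> `|y| <= k.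
Proof.
move=> lip sg; rewrite ler_norml; apply/andP; split.
- have := sg (t - 1); have := lipschitz_dist (t - 1) t lip.
  rewrite (_ : t - 1 - t = - 1); last by ring.
  by rewrite normrN1 ler_norml => /andP[]; lra.
- have := sg (t + 1); have := lipschitz_dist (t + 1) t lip.
  rewrite (_ : t + 1 - t = 1); last by ring.
  by rewrite normr1 ler_norml => /andP[]; lra.
Qed.

(** Comparing losses at two points only needs a slope bounded by the Lipschitz
    constant, so a secant slope does the work of a second subgradient.  At
    [s = t] its value is 0. *)
Definition secant l s t : R := (l s - l t) / (s - t).

Lemma secantE l s t : secant l s t * (s - t) = l s - l t.
Proof.
by have [->|st] := eqVneq s t; rewrite ?subrr ?mulr0// divfK// subr_eq0.
Qed.

Lemma secant_lipschitz (k : R) l s t : 0 <= k ->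
  k.-lipschitz (l : R^o -> R^o) -> `|secant l s t| <= k.
Proof.
move=> k0 lip; have [->|st] := eqVneq s t.
  by rewrite /secant subrr mul0r normr0.
rewrite normrM normfV ler_pdivrMr ?normr_gt0 ?subr_eq0//.
exact: lipschitz_dist.
Qed.

Lemma fenchel_young l t y : ((y * t - l t)%:E <= convex_conjugate l y)%E.
Proof. by apply: ereal_sup_ubound; exists t. Qed.

Lemma conjugate_subgradient l t y : subgradient l t y ->
  convex_conjugate l y = (y * t - l t)%:E.
Proof.
move=> sg; apply/le_anti/andP; split; last exact: fenchel_young.
by apply: ub_ereal_sup => _ [u _ <-]; rewrite lee_fin; have := sg u; lra.
Qed.

(** The conjugates may take the value [+oo], so the finiteness of the maximum has
    to be proved first: by choosing a subgradient of each [l j] at [t j] one sees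
    that the maximum is at least the sum of the [l j (t j)].  By Fenchel-Young no
    coordinate contributes more than [l j (t j)], hence each contributes exactly
    this, and equality in Fenchel-Young means that [y j 0] is a subgradient. *)
Lemma argmax_conjugate (b : nat) (l : 'I_b -> R -> R) (t : 'I_b -> R)
    (y : 'cV[R]_b) :
    (forall j, convex_function setT (l j : R^o -> R^o)) ->
    argmax (fun z : 'cV[R]_b => (\sum_j z j 0 * t j)%:E -
      \sum_j convex_conjugate (l j) (z j 0)%R)%E y ->
  forall j, subgradient (l j) (t j) (y j 0).
Proof.
move=> cvx ymax.
have /choice[g sg] : forall j, exists g, subgradient (l j) (t j) g.
  by move=> j; exact: convex_subgradient.
have := ymax (\col_j g j).
under [X in (_ - X <= _)%E]eq_bigr => j _ do
  rewrite mxE (conjugate_subgradient (sg j)).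
rewrite sumEFin -EFinB -sumrB.
under eq_bigr => j _ do rewrite mxE subKr.
move=> opt.
have conj_fin j : convex_conjugate (l j) (y j 0) \is a fin_num.
  have conjN i : convex_conjugate (l i) (y i 0) != -oo%E.
    by rewrite gt_eqF// (lt_le_trans _ (fenchel_young _ (t i) _))// ltNyr.
  case E : (convex_conjugate (l j) (y j 0)) => [r||] //; last first.
    by move: (conjN j); rewrite E.
  move: opt; rewrite (_ : \sum_j _ = +oo)%E//.
  apply/esum_eqyP => [i _|]; first exact: conjN.
  by exists j; rewrite mem_index_enum E.
pose c j := fine (convex_conjugate (l j) (y j 0)).
have cE j : convex_conjugate (l j) (y j 0) = (c j)%:E by rewrite fineK.
have FY j u : y j 0 * u - c j <= l j u.
  by have := fenchel_young (l j) u (y j 0); rewrite cE lee_fin; lra.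
move: opt; under [X in (_ <= _ - X)%E]eq_bigr => j _ do rewrite cE.
rewrite sumEFin -EFinB lee_fin -sumrB => opt j u.
suff : y j 0 * t j - c j = l j (t j) by move: (FY j u); lra.
apply/le_anti; rewrite FY/= -subr_le0.
have gap0 i : 0 <= l i (t i) - (y i 0 * t i - c i) by rewrite subr_ge0.
apply: (@le_trans _ _ (\sum_i (l i (t i) - (y i 0 * t i - c i)))).
  by rewrite (bigD1 j)//= lerDl; apply: sumr_ge0.
by rewrite sumrB subr_le0.
Qed.

End Subgradient.

(** * Decomposition of the positions into batches *)

Section Batches.
Context {R : realType} {b m : nat}.

Lemma batch_pos_div (i : 'I_m) (j : 'I_b) : (batch_pos i j %/ b = i)%N.
Proof.
have b0 : (0 < b)%N by apply: leq_ltn_trans (ltn_ord j).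
by rewrite /= mulnC divnMDl// divn_small ?addn0.
Qed.

Lemma batch_pos_bij : bijective (fun ij : 'I_m * 'I_b => batch_pos ij.1 ij.2).
Proof.
apply: inj_card_bij; last by rewrite card_prod !card_ord mulnC.
move=> [i j] [i' j'] /= E.
have ii' : i = i'.
  by apply: val_inj; have := batch_pos_div i j; rewrite E batch_pos_div.
congr pair => //; apply: val_inj; move/(congr1 val): E => /= /eqP.
by rewrite ii' eqn_add2l => /eqP.
Qed.

Lemma sum_batch_pos (V : nmodType) (F : 'I_(b * m) -> V) :
  \sum_p F p = \sum_i \sum_j F (batch_pos i j).
Proof.
rewrite pair_bigA/= (reindex (fun ij : 'I_m * 'I_b => batch_pos ij.1 ij.2))//=.
exact/onW_bij/batch_pos_bij.
Qed.

Lemma batch_posP (p : 'I_(b * m)) : exists i j, p = batch_pos i j.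
Proof.
by have [h _ hK] := batch_pos_bij; exists (h p).1, (h p).2; rewrite hK.
Qed.

(** Gathers per-batch data, such as the dual vectors of an epoch, into one vector
    on which the matrices in [G_hat] and [G_tilde] act. *)
Lemma stack_batches (f : 'I_m -> 'I_b -> R) :
  exists w : 'cV[R]_(b * m), forall i j, w (batch_pos i j) 0 = f i j.
Proof.
have [h hK _] := batch_pos_bij.
exists (\col_p f (h p).1 (h p).2) => i j.
by rewrite mxE; have /= -> := hK (i, j).
Qed.

Lemma batch_pos_ge (i : nat) (i' : 'I_m) (j : 'I_b) :
  (b * i <= batch_pos i' j)%N = (i <= i')%N.
Proof.
have b0 : (0 < b)%N by apply: leq_ltn_trans (ltn_ord j).
by rewrite mulnC -leq_divRL// batch_pos_div.
Qed.

Lemma mem_batch (i : nat) (i' : 'I_m) (j : 'I_b) :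
  (b * i <= batch_pos i' j < b * i.+1)%N = (i' == i :> nat).
Proof. by rewrite ltnNge !batch_pos_ge -ltnNge ltnS andbC -eqn_leq. Qed.

Lemma id_from_sum_batch (i : nat) :
  id_from (b * i) = \sum_(i <= j < m) id_batch b j :> 'M[R]_(b * m).
Proof.
rewrite /id_from /id_batch -linear_sum/=; congr diag_mx; apply/rowP => p.
rewrite summxE mxE; have [i' [j ->]] := batch_posP p.
under eq_bigr do rewrite mxE mem_batch.
rewrite batch_pos_ge; have [ii'|i'i] := leqP i i'.
  rewrite (bigD1_seq (i' : nat)) ?iota_uniq//=; last first.
    by rewrite mem_index_iota ii' ltn_ord.
  rewrite eqxx big1 ?addr0// => k /negbTE; rewrite eq_sym => -> //.
rewrite big_nat big1// => k /andP[ik _].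
by rewrite ltn_eqF// (leq_trans i'i).
Qed.

End Batches.

(** * Progress in one epoch *)

Section Epoch.
Context {R : realType} {b m d : nat}.
Local Notation n := (b * m)%N.
Variables (a : 'I_n -> 'cV[R]_d) (ell : 'I_n -> R -> R) (G : 'I_n -> R).
Variables (pi : 'S_n).
Hypotheses (b_gt0 : (0 < b)%N) (m_gt0 : (0 < m)%N).
Hypothesis ell_convex :
  forall i, convex_function setT (ell i : R^o -> R^o).
Hypothesis G_gt0 : forall i, 0 < G i.
Hypothesis ell_lipschitz : forall i, (G i).-lipschitz (ell i : R^o -> R^o).

Local Notation A := (data_mx a pi).

Lemma batch_gradient_dot (i : 'I_m) (w : 'cV[R]_n) (u : 'cV[R]_d) :
  dot (A^T *m id_batch b i *m w) u =
  \sum_j w (batch_pos i j) 0 * dot (a (pi (batch_pos i j))) u.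
Proof.
rewrite dot_mulmx trmx_mul trmxK tr_diag_mx -mulmxA mul_diag_mx dotE.
rewrite sum_batch_pos (bigD1 i)//= [X in _ + X]big1 ?addr0 => [|i' i'i].
  apply: eq_bigr => j _; rewrite !mxE mem_batch eqxx mul1r; congr (_ * _).
  by rewrite dotE; apply: eq_bigr => l _; rewrite mxE.
apply: big1 => j _; rewrite !mxE mem_batch.
by rewrite val_eqE (negbTE i'i) mul0r mulr0.
Qed.

Lemma batch_mx_stack (i : 'I_m) (w : 'cV[R]_n) (y : 'cV[R]_b) :
  (forall j, w (batch_pos i j) 0 = y j 0) ->
  (batch_mx a pi i)^T *m y = A^T *m id_batch b i *m w.
Proof.
move=> wy; apply/colP => l; rewrite -mulmxA mul_diag_mx !mxE sum_batch_pos.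
rewrite (bigD1 i)//= [X in _ + X]big1 ?addr0 => [|i' i'i].
  by apply: eq_bigr => j _; rewrite !mxE mem_batch eqxx mul1r wy.
apply: big1 => j _; rewrite !mxE mem_batch.
by rewrite val_eqE (negbTE i'i) mul0r mulr0.
Qed.

(** Completing the square: the primal objective exceeds its value at the
    gradient step by [b / (2 eta)] times the squared distance to it. *)
Lemma primal_step (i : 'I_m) (eta : R) (x z : 'cV[R]_d) (y : 'cV[R]_b) :
  0 < eta -> argmin (primal_objective a pi i eta x y) z ->
  z = x - (eta / b%:R) *: ((batch_mx a pi i)^T *m y).
Proof.
move=> eta0 zmin; set g := _ *m y.
have b0 : 0 < b%:R :> R by rewrite ltr0n.
set z0 := x - _; apply/eqP; rewrite -subr_eq0; apply/eqP/dot_eq0.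
have := zmin z0.
have {1}-> : z = z0 + (z - z0) by rewrite addrC subrK.
have objE w : primal_objective a pi i eta x y w =
    dot g w + b%:R / (2 * eta) * dot (w - x) (w - x).
  by rewrite /primal_objective sqr_l2norm /g dot_mulmx trmxK /dot mulmxA.
move: (z - z0) => e; rewrite !objE.
pose c := - (eta / b%:R).
rewrite (_ : z0 - x = c *: g); last by rewrite /z0 addrAC subrr add0r scaleNr.
rewrite (_ : z0 + e - x = e + c *: g); last first.
  by rewrite /z0 scaleNr addrAC [x - _ - x]addrAC subrr add0r addrC.
rewrite !dotDr !dotDl !dotZl !dotZr (dotC e g) /c.
set ge := dot g e; set gg := dot g g; set ee := dot e e; set gz := dot g z0.
rewrite -subr_le0.
set lhs := (X in X <= 0 -> _).
have -> : lhs = b%:R / (2 * eta) * ee.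
  by rewrite /lhs; field; rewrite !gt_eqF.
by rewrite pmulr_rle0// divr_gt0// mulr_gt0.
Qed.

Lemma dual_step (i : 'I_m) (x : 'cV[R]_d) (y : 'cV[R]_b) :
  argmax (dual_objective a ell pi i x) y ->
  forall j, subgradient (ell (pi (batch_pos i j)))
                        (dot (a (pi (batch_pos i j))) x) (y j 0).
Proof.
move=> ymax; apply: argmax_conjugate => [j|]; first exact: ell_convex.
suff <- : dual_objective a ell pi i x = (fun z : 'cV[R]_b =>
  (\sum_j z j 0 * dot (a (pi (batch_pos i j))) x)%:E -
  \sum_j convex_conjugate (ell (pi (batch_pos i j))) (z j 0)%R)%E by [].
apply/funext => z; rewrite /dual_objective -mulmxA -/(dot _ _) dotE.
congr (_%:E - _)%E; apply: eq_bigr => j _; congr (_ * _).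
by rewrite mxE dotE; apply: eq_bigr => l _; rewrite !mxE.
Qed.

(** Writing [w] as the square root of Gamma times [u] turns the bound on the
    entries of [w] into [|u p 0| <= c], so that the squared norm of [u] is at most
    [c ^ 2 n]. *)
Lemma le_sum_sqr_scaled (J : finType) (D : J -> 'M[R]_n) (c : R)
    (w : 'cV[R]_n) :
    0 <= c -> (forall j, (D j)^T = D j) ->
    (forall p, `|w p 0| <= c * G (pi p)) ->
  \sum_j dot (A^T *m D j *m w) (A^T *m D j *m w) <=
  opnorm (sqrt_Gamma G pi *m (\sum_j D j *m A *m A^T *m D j) *m sqrt_Gamma G pi)
    * (c ^+ 2 * n%:R).
Proof.
move=> c0 DT wG; pose u : 'cV[R]_n := \col_p (w p 0 / G (pi p)).
have wE : w = sqrt_Gamma G pi *m u.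
  rewrite mul_diag_mx; apply/colP => p; rewrite !mxE sqrtr_sqr gtr0_norm//.
  by rewrite mulrC divfK// gt_eqF.
rewrite {1 2}wE.
apply: le_trans (le_sum_sqr_opnorm _ _ (tr_diag_mx _) DT) _.
rewrite ler_wpM2l ?opnorm_ge0// dotE.
apply: (@le_trans _ _ (\sum_(p < n) c ^+ 2)); last first.
  by rewrite sumr_const card_ord mulr_natr.
apply: ler_sum => p _; rewrite mxE -expr2 -real_normK ?num_real//.
rewrite lerXn2r ?nnegrE// normrM normfV (gtr0_norm (G_gt0 _)).
by rewrite ler_pdivrMr.
Qed.

(** The vector [w] stands for the differences between secant slopes and dual
    coordinates, whence the factor 2 in its bound.  The two sums of squares are at
    most [4 n b G_tilde] and [n m n G_hat]; as [n = b m], the square root of their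
    product is [2 n ^ 2 sqrt (G_hat G_tilde)]. *)
Lemma drift_le (y w : 'cV[R]_n) :
    (forall p, `|y p 0| <= G (pi p)) -> (forall p, `|w p 0| <= 2 * G (pi p)) ->
  - \sum_(i < m) dot (A^T *m id_batch b i *m w) (A^T *m id_from (b * i) *m y)
  <= 2 * n%:R ^+ 2 * Num.sqrt (G_hat a G b m pi * G_tilde a G b m pi).
Proof.
move=> yG wG; apply: le_trans (cauchy_schwarz_sum _ _) _.
have n0 : 0 < n%:R :> R by rewrite ltr0n muln_gt0 b_gt0.
have b0 : 0 < b%:R :> R by rewrite ltr0n.
have -> : 2 * n%:R ^+ 2 = Num.sqrt ((2 * n%:R ^+ 2) ^+ 2) :> R.
  by rewrite sqrtr_sqr ger0_norm// mulr_ge0// exprn_ge0// ltW.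
rewrite -sqrtrM ?sqr_ge0//; apply: ler_wsqrtr.
have -> : (2 * n%:R ^+ 2) ^+ 2 * (G_hat a G b m pi * G_tilde a G b m pi) =
  (b%:R * G_tilde a G b m pi * (2 ^+ 2 * n%:R)) *
  ((m * n)%N%:R * G_hat a G b m pi * (1 ^+ 2 * n%:R)).
  rewrite !natrM; ring.
apply: ler_pM; try by apply: sumr_ge0 => i _; exact: dot_ge0.
- rewrite /G_tilde mulVKf ?gt_eqF//.
  apply: (le_sum_sqr_scaled (D := fun j : 'I_m => id_batch b j)) => //.
  by move=> j; rewrite tr_diag_mx.
- rewrite /G_hat mulVKf ?pnatr_eq0 -?lt0n ?muln_gt0 ?m_gt0 ?b_gt0//.
  apply: (le_sum_sqr_scaled (D := fun j : 'I_m => id_from (b * j))) => //.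
    by move=> j; rewrite tr_diag_mx.
  by move=> p; rewrite mul1r.
Qed.

Lemma three_point (u v w : 'cV[R]_d) :
  2 * dot (u - v) (v - w) =
  dot (u - w) (u - w) - dot (v - w) (v - w) - dot (u - v) (u - v).
Proof.
have -> : u - w = (u - v) + (v - w) by rewrite addrA subrK.
by rewrite !(dotDl (u - v)) !(dotDr _ (u - v)) (dotC (v - w) (u - v)); ring.
Qed.

(** The vectors [g i] sum to a multiple of [x 0 - x m], so the gradient terms
    form the left-hand side of [three_point]; among its right-hand terms, minus
    the squared length of the move of the whole epoch is bounded above by 0.
    The remaining terms are the drift, of order [eta]; multiplying by [eta]
    makes it the quadratic error. *)
Lemma epoch_progress (eta : R) (x : nat -> 'cV[R]_d) (y : 'I_m -> 'cV[R]_b)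
    (z : 'cV[R]_d) :
    0 < eta ->
    (forall i : 'I_m, argmax (dual_objective a ell pi i (x i)) (y i)) ->
    (forall i : 'I_m,
       argmin (primal_objective a pi i eta (x i) (y i)) (x i.+1)) ->
  eta * (objective a ell (x m) - objective a ell z) <=
  b%:R / (2 * n%:R) * (l2norm (x 0 - z) ^+ 2 - l2norm (x m - z) ^+ 2) +
  2 * eta ^+ 2 * n%:R * Num.sqrt (G_hat a G b m pi * G_tilde a G b m pi) / b%:R.
Proof.
move=> eta0 ymax xmin.
have n0 : 0 < n%:R :> R by rewrite ltr0n muln_gt0 b_gt0.
have b0 : 0 < b%:R :> R by rewrite ltr0n.
have [Y YE] := stack_batches (fun i j => y i j 0).
pose t i j u := dot (a (pi (batch_pos i j))) u.
pose v (i : 'I_m) (j : 'I_b) :=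
  secant (ell (pi (batch_pos i j))) (t i j (x m)) (t i j (x i)).
have [W WE] := stack_batches (fun i j => v i j - y i j 0).
have sg i j := dual_step (ymax i) j.
have YG p : `|Y p 0| <= G (pi p).
  have [i [j ->]] := batch_posP p; rewrite YE.
  exact: subgradient_lipschitz (sg i j).
have WG p : `|W p 0| <= 2 * G (pi p).
  have := YG p; have [i [j ->]] := batch_posP p; rewrite YE WE => yG.
  apply: le_trans (ler_normB _ _) _; rewrite mulr_natl mulr2n lerD//.
  by apply: secant_lipschitz => //; exact: ltW.
pose g i := A^T *m id_batch b i *m Y.
have step (i : nat) : (i < m)%N -> x i.+1 - x i = - ((eta / b%:R) *: g i).
  move=> im; have /= -> := primal_step eta0 (xmin (Ordinal im)).
  rewrite (batch_mx_stack (w := Y)) => [|j]; last by rewrite YE.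
  by rewrite addrAC subrr add0r.
have tail (i : nat) : (i <= m)%N ->
    x m - x i = - ((eta / b%:R) *: (A^T *m id_from (b * i) *m Y)).
  move=> im; rewrite -telescope_sumr// big_nat.
  under eq_bigr => k /andP[_ km] do rewrite step//.
  rewrite -big_nat sumrN -scaler_sumr /g id_from_sum_batch.
  by rewrite mulmx_sumr mulmx_suml.
have head : x 0 - x m = (eta / b%:R) *: \sum_(i < m) g i.
  rewrite -opprB tail// opprK id_from_sum_batch mulmx_sumr mulmx_suml.
  by rewrite big_mkord.
have gap : n%:R * (objective a ell (x m) - objective a ell z) <=
    \sum_(i < m) dot (g i) (x m - z) +
    \sum_(i < m) dot (A^T *m id_batch b i *m W) (x m - x i).
  rewrite /objective -mulrBr mulVKf ?gt_eqF// -sumrB.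
  rewrite (reindex_inj (@perm_inj _ pi))/= sum_batch_pos -big_split/=.
  apply: ler_sum => i _; rewrite /g !batch_gradient_dot -big_split/=.
  apply: ler_sum => j _; rewrite -!/(dot _ _) YE WE !dotBr.
  have := sg i j (t i j z).
  have := secantE (ell (pi (batch_pos i j))) (t i j (x m)) (t i j (x i)).
  rewrite -/(v i j) /t; lra.
have main : \sum_(i < m) dot (g i) (x m - z) =
    b%:R / (2 * eta) * (2 * dot (x 0 - x m) (x m - z)).
  by rewrite -dot_suml head dotZl; field; rewrite !gt_eqF.
have drift : \sum_(i < m) dot (A^T *m id_batch b i *m W) (x m - x i) <=
    eta / b%:R *
    (2 * n%:R ^+ 2 * Num.sqrt (G_hat a G b m pi * G_tilde a G b m pi)).
  apply: le_trans (ler_wpM2l _ (drift_le YG WG)); last by rewrite divr_ge0 ?ltW.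
  rewrite mulrN mulr_sumr -sumrN; apply: ler_sum => i _.
  by rewrite tail ?(ltnW (ltn_ord i))// -scaleNr dotZr mulNr.
move: gap; rewrite main three_point => gap.
have := le_trans gap (lerD (lexx _) drift).
have dd0 := dot_ge0 (x 0 - x m).
set gg := Num.sqrt _; rewrite !sqr_l2norm.
set X := dot (x 0 - z) _; set Z := dot (x m - z) _.
set D := objective _ _ _ - _.
rewrite -(ler_pM2l (x := eta / n%:R)) ?divr_gt0// => H.
move: n0 H; move: (n%:R) => N N0 H.
have -> : eta * D = eta / N * (N * D).
  by rewrite mulrA divfK// gt_eqF.
apply: le_trans H _.
have -> : eta / N * (b%:R / (2 * eta) * (X - Z - dot (x 0 - x m) (x 0 - x m))
   + eta / b%:R * (2 * N ^+ 2 * gg)) =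
   b%:R / (2 * N) * (X - Z) + 2 * eta ^+ 2 * N * gg / b%:R
   - b%:R / (2 * N) * dot (x 0 - x m) (x 0 - x m).
  by field; rewrite !gt_eqF.
rewrite gerBl; apply: mulr_ge0 => //.
by apply: divr_ge0; rewrite ?mulr_ge0// ltW.
Qed.

End Epoch.

(** * Bound along a run *)

Section Run.
Context {R : realType} {b m d K : nat}.
Local Notation n := (b * m)%N.
Variables (a : 'I_n -> 'cV[R]_d) (ell : 'I_n -> R -> R) (G : 'I_n -> R).
Hypotheses (b_gt0 : (0 < b)%N) (m_gt0 : (0 < m)%N) (K_gt0 : (0 < K)%N).
Hypothesis ell_convex :
  forall i, convex_function setT (ell i : R^o -> R^o).
Hypothesis G_gt0 : forall i, 0 < G i.
Hypothesis ell_lipschitz : forall i, (G i).-lipschitz (ell i : R^o -> R^o).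

Lemma objective_subgradient (u : 'cV[R]_d) :
  exists s, forall x, objective a ell u + dot s (x - u) <= objective a ell x.
Proof.
have /choice[g sg] : forall i, exists g, subgradient (ell i) (dot (a i) u) g.
  by move=> i; exact: convex_subgradient.
exists (n%:R^-1 *: \sum_i g i *: a i) => x.
rewrite dotZl dot_suml /objective -mulrDr ler_wpM2l ?invr_ge0// -big_split/=.
apply: ler_sum => i _; rewrite dotZl dotBr; exact: sg.
Qed.

(** Jensen's inequality: average the affine minorant of the objective at the
    weighted mean [u]; its linear part averages to 0. *)
Lemma objective_weighted_mean (eta : 'I_K -> R) (x : 'I_K -> 'cV[R]_d) :
  (forall k, 0 < eta k) ->
  (\sum_k eta k) *
    objective a ell ((\sum_k eta k)^-1 *: \sum_k eta k *: x k) <=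
  \sum_k eta k * objective a ell (x k).
Proof.
move=> eta0; set H := \sum_k eta k; set u := _ *: _.
have H0 : 0 < H.
  rewrite /H (bigD1 (Ordinal K_gt0))//= ltr_pwDl//.
  by apply: sumr_ge0 => k _; exact: ltW.
have [s sg] := objective_subgradient u.
have bary : \sum_k eta k *: (x k - u) = 0.
  under eq_bigr do rewrite scalerBr.
  by rewrite sumrB -scaler_suml -/H scalerA mulfV ?gt_eqF// scale1r subrr.
apply: (@le_trans _ _
  (\sum_k eta k * (objective a ell u + dot s (x k - u)))); last first.
  by apply: ler_sum => k _; rewrite ler_wpM2l// ltW.
under eq_bigr do rewrite mulrDr -dotZr.
rewrite big_split/= -dot_sumr bary -mulr_suml.
by rewrite -[X in dot s X](scale0r s) dotZr mul0r addr0.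
Qed.

Lemma run_bound (x0 z : 'cV[R]_d) (eta : 'I_K -> R) (pi : 'I_K -> 'S_n)
    (r : sgd_run a ell x0 eta pi) :
  (forall k, 0 < eta k) ->
  (\sum_k eta k) * (objective a ell (output r) - objective a ell z) <=
  b%:R / (2 * n%:R) * l2norm (x0 - z) ^+ 2 +
  \sum_k 2 * eta k ^+ 2 * n%:R / b%:R *
    Num.sqrt (G_hat a G b m (pi k) * G_tilde a G b m (pi k)).
Proof.
move=> eta0; rewrite mulrBr.
apply: le_trans (lerB (objective_weighted_mean (fun k => outer r k.+1) eta0)
  (lexx _)) _.
rewrite mulr_suml -sumrB.
pose dist k := l2norm (outer r k - z) ^+ 2.
apply: (@le_trans _ _ (\sum_(k < K)
    (b%:R / (2 * n%:R) * (dist k - dist k.+1) + 2 * eta k ^+ 2 * n%:R / b%:R *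
      Num.sqrt (G_hat a G b m (pi k) * G_tilde a G b m (pi k))))).
  apply: ler_sum => k _; rewrite -mulrBr run_end.
  have := epoch_progress b_gt0 m_gt0 ell_convex G_gt0 ell_lipschitz z (eta0 k)
    (run_dual r k) (run_primal r k).
  by rewrite run_start [_ / b%:R * _]mulrAC /dist run_end.
rewrite big_split/= lerD2r -mulr_sumr ler_wpM2l ?divr_ge0 ?mulr_ge0//.
rewrite -(big_mkord xpredT (fun k => dist k - dist k.+1)).
under eq_bigr do rewrite -opprB.
rewrite sumrN telescope_sumr// opprB {1}/dist run_init gerBl.
exact: sqr_ge0.
Qed.

End Run.

(** * Expectation over the shuffling *)

Section Expectation.
Context {R : realType}.

Lemma le_expectation_unif (W : finType) (F H : W -> R) :
  (forall w, F w <= H w) -> expectation_unif F <= expectation_unif H.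
Proof. by move=> FH; rewrite ler_wpM2r ?invr_ge0//; apply: ler_sum. Qed.

Lemma expectation_unif_affine (W : finType) (I : finType) (w0 : W) (c : R)
    (e : I -> R) (F : I -> W -> R) :
  expectation_unif (fun w => c + \sum_i e i * F i w) =
  c + \sum_i e i * expectation_unif (F i).
Proof.
have W0 : #|W|%:R != 0 :> R.
  by rewrite pnatr_eq0 -lt0n; apply/card_gt0P; exists w0.
rewrite /expectation_unif big_split/= mulrDl sumr_const -(mulr_natr c) mulfK//.
congr (_ + _); rewrite exchange_big mulr_suml; apply: eq_bigr => i _.
by rewrite -mulr_sumr mulrA.
Qed.

(** The coordinates of a uniform finite function are uniform: the sum over all
    functions factors through [k], the other coordinates contributing the constant
    factor [T] that also relates the cardinals. *)
Lemma expectation_unif_coord (I S : finType) (k : I) (s0 : S) (F : S -> R) :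
  expectation_unif (fun w : {ffun I -> S} => F (w k)) = expectation_unif F.
Proof.
pose T : R := \prod_(i : I | i != k) \sum_(x : S) 1.
have marginal H : \sum_(w : {ffun I -> S}) H (w k) = (\sum_x H x) * T.
  pose P i x := if i == k then H x else 1.
  transitivity (\prod_i \sum_x P i x).
    rewrite bigA_distr_bigA/=; apply: eq_bigr => w _.
    rewrite (bigD1 k)//= /P eqxx big1 ?mulr1// => i /negbTE -> //.
  rewrite (bigD1 k)//=; congr (_ * _); first by rewrite /P eqxx.
  by apply: eq_bigr => i /negbTE ik; rewrite /P ik.
have cardE : #|{ffun I -> S}|%:R = #|S|%:R * T.
  have := marginal (fun=> 1); rewrite !sumr_const => <-.
  by rewrite -mulr_natr mul1r.
have T0 : T != 0.
  have : #|{ffun I -> S}|%:R != 0 :> R.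
    by rewrite pnatr_eq0 -lt0n; apply/card_gt0P; exists [ffun=> s0].
  by rewrite cardE mulf_eq0 negb_or => /andP[].
by rewrite /expectation_unif marginal cardE -mulf_div divff// mulr1.
Qed.

Lemma expectation_epoch_perm b m d (a : 'I_(b * m) -> 'cV[R]_d) G K
    (s : scheme (b * m)) (k : 'I_K) :
  expectation_unif (fun w : sample K s =>
    Num.sqrt (G_hat a G b m (epoch_perm w k) *
              G_tilde a G b m (epoch_perm w k))) = G_bar a G s.
Proof.
case: s => [||pi0] //=.
  exact: (expectation_unif_coord k 1%g
    (fun pi => Num.sqrt (G_hat a G b m pi * G_tilde a G b m pi))).
by rewrite /expectation_unif sumr_const card_unit divr1.
Qed.

Lemma sample_inhabited n K (s : scheme n) : sample K s.
Proof. by case: s => [||pi0]; [exact: [ffun=> 1%g]|exact: 1%g|exact: tt]. Qed.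

Lemma G_bar_ge0 b m d (a : 'I_(b * m) -> 'cV[R]_d) G (s : scheme (b * m)) :
  0 <= G_bar a G s.
Proof.
by case: s => [||pi0]; rewrite /G_bar ?sqrtr_ge0// divr_ge0//;
   apply: sumr_ge0 => pi _; exact: sqrtr_ge0.
Qed.

End Expectation.

(** * Convergence and complexity *)

Theorem theorem3 (R : realType) :
  exists C : R, 0 < C /\
  forall (b m d : nat) (b_gt0 : (0 < b)%N) (m_gt0 : (0 < m)%N)
    (d_gt0 : (0 < d)%N)
    (a : 'I_(b * m) -> 'cV[R]_d) (ell : 'I_(b * m) -> R -> R)
    (G : 'I_(b * m) -> R)
    (ell_convex : forall i, convex_function setT (ell i : R^o -> R^o))
    (G_gt0 : forall i, 0 < G i)
    (ell_lipschitz : forall i, (G i).-lipschitz (ell i : R^o -> R^o))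
    (xstar : 'cV[R]_d) (xstar_min : argmin (objective a ell) xstar)
    (x0 : 'cV[R]_d) (s : scheme (b * m)),
  (forall (K : nat) (K_gt0 : (0 < K)%N) (eta : 'I_K -> R)
      (eta_gt0 : forall k, 0 < eta k)
      (run : forall w : sample K s, sgd_run a ell x0 eta (epoch_perm w)),
    expectation_unif (fun w : sample K s =>
      (\sum_(k < K) eta k) *
      (objective a ell (output (run w)) - objective a ell xstar))
    <= b%:R / (2 * (b * m)%N%:R) * l2norm (x0 - xstar) ^+ 2
       + \sum_(k < K) 2 * eta k ^+ 2 * (b * m)%N%:R * G_bar a G s / b%:R)
  /\
  (forall (eps : R) (eps_gt0 : 0 < eps) (K : nat) (K_gt0 : (0 < K)%N),
    C * (b * m)%N%:R * G_bar a G s * l2norm (x0 - xstar) ^+ 2 / eps ^+ 2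
      <= (b * m * K)%N%:R ->
    exists eta : R, 0 < eta /\
      forall run : forall w : sample K s,
          sgd_run a ell x0 (fun=> eta) (epoch_perm w),
        expectation_unif (fun w : sample K s =>
          objective a ell (output (run w)) - objective a ell xstar) <= eps).
Proof.
exists 4; split=> //; move=> b m d b_gt0 m_gt0 _ a ell G cvx G_gt0 lip z _ x0 s.
have n_gt0 : 0 < (b * m)%N%:R :> R by rewrite ltr0n muln_gt0 b_gt0.
have bR_gt0 : 0 < b%:R :> R by rewrite ltr0n.
have part1 (K : nat) (K_gt0 : (0 < K)%N) (eta : 'I_K -> R)
    (eta_gt0 : forall k, 0 < eta k)
    (run : forall w : sample K s, sgd_run a ell x0 eta (epoch_perm w)) :
  expectation_unif (fun w : sample K s =>
    (\sum_(k < K) eta k) *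
    (objective a ell (output (run w)) - objective a ell z))
  <= b%:R / (2 * (b * m)%N%:R) * l2norm (x0 - z) ^+ 2
     + \sum_(k < K) 2 * eta k ^+ 2 * (b * m)%N%:R * G_bar a G s / b%:R.
  apply: le_trans (le_expectation_unif (fun w => run_bound b_gt0 m_gt0 K_gt0
    cvx G_gt0 lip z (run w) eta_gt0)) _.
  rewrite (expectation_unif_affine (sample_inhabited K s)) lerD2l.
  by apply: ler_sum => k _; rewrite expectation_epoch_perm [leRHS]mulrAC.
split=> // eps eps_gt0 K K_gt0 budget.
set D := l2norm (x0 - z) ^+ 2 in part1 budget *.
have D0 : 0 <= D by exact: sqr_ge0.
have KR_gt0 : 0 < K%:R :> R by rewrite ltr0n.
(* It remains to choose eta; both sides are multiplied by K eta. *)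
suff [eta [eta0 etaP]] : exists eta : R, 0 < eta /\
    b%:R / (2 * (b * m)%N%:R) * D +
    K%:R * (2 * eta ^+ 2 * (b * m)%N%:R * G_bar a G s / b%:R)
    <= K%:R * eta * eps.
  exists eta; split=> // run; have := part1 K K_gt0 _ (fun=> eta0) run.
  have sum_const (c : R) : \sum_(k < K) c = K%:R * c.
    by rewrite sumr_const card_ord mulr_natl.
  rewrite !sum_const => H.
  have Keta : 0 < K%:R * eta by rewrite mulr_gt0.
  rewrite -(ler_pM2l Keta); apply: le_trans etaP; apply: le_trans H.
  by rewrite /expectation_unif -mulr_sumr mulrA.
move: budget; rewrite [leRHS]natrM.
move: (G_bar_ge0 a G s) => g0; move: (G_bar a G s) g0 => g g0.
move: n_gt0; move: ((b * m)%N%:R) => N N0.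
move: bR_gt0; move: (b%:R) => B B0.
move: KR_gt0; move: (K%:R) => k k0 budget.
have {budget} budget : 4 * g * D <= k * eps ^+ 2.
  rewrite -(ler_pM2l N0) [leRHS]mulrA -ler_pdivrMr ?exprn_gt0//.
  by move: budget; rewrite !mulrA [N * 4]mulrC.
move: g0; rewrite le_eqVlt => /predU1P[g0|g0].
(* If G_bar = 0, only the first term is left and any large enough
   step size will do. *)
- exists (B * D / (2 * N * k * eps) + 1); split.
    have den0 : 0 < 2 * N * k * eps by rewrite !mulr_gt0.
    by rewrite ltr_wpDl// divr_ge0 ?(ltW den0)// mulr_ge0// ltW.
  rewrite -g0 mulr0 mul0r mulr0 addr0.
  have -> : k * (B * D / (2 * N * k * eps) + 1) * eps =
     B / (2 * N) * D + k * eps by field; rewrite !gt_eqF.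
  by rewrite lerDl mulr_ge0// ltW.
(* After division by K eta, this step size makes the second term exactly half of
   eps, and the budget on K says that the first one is at most the other half. *)
- exists (eps * B / (4 * N * g)); split.
    by rewrite divr_gt0// ?mulr_gt0.
  rewrite -subr_ge0.
  set lhs := (X in 0 <= X).
  have -> : lhs = B / (8 * N * g) * (k * eps ^+ 2 - 4 * g * D).
    by rewrite /lhs; field; rewrite !gt_eqF.
  by rewrite mulr_ge0 ?subr_ge0// divr_ge0// ?mulr_ge0// ltW.
Qed.
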